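(* Let $X=\{\sigma_1,\dots,\sigma_K\}$ be a finite simplicial complex such that $X_k=\{\sigma_1,\dots,\sigma_k\}$ is a subcomplex of $X$ for every $1\le k\le K$, let $X_0=\emptyset$, and let $\mathbb{X}: \emptyset=X_0\subset X_1\subset\cdots\subset X_K=X$ be the resulting filtration. Let $q\ge 0$ and let $D_q(\mathbb{X})$ be its $q$-th persistence diagram with coefficients in a field $\Bbbk$. Then for every birth-death pair $(b_i,d_i)\in D_q(\mathbb{X})$ with $d_i<\infty$ there exists a persistent volume for $(b_i,d_i)$.
   Context: Coefficients are in a field $\Bbbk$. $C_q(X)$ is the simplicial $q$-chain space of $X$ and $\partial$ the boundary operator. The persistent homology $H_q(\mathbb{X})$ is the family of vector spaces $H_q(X_k)$, $0\le k\le K$, with the maps induced by the inclusions $X_s\subset X_t$ ($s\le t$). It decomposes uniquely as $\bigoplus_{i=1}^p I(b_i,d_i)$ with $b_i<d_i\le\infty$, where the interval module $I(b,d)$ is $\Bbbk$ at indices $k$ with $b\le k<d$ and $0$ elsewhere, with identity maps between the nonzero spaces and zero maps otherwise. The $q$-th persistence diagram is the multiset $D_q(\mathbb{X})=\{(b_i,d_i)\mid i=1,\dots,p\}$, and its elements are called birth-death pairs. For a $q$-simplex $\sigma_k$, let $\sigma_k^*$ be the linear functional on $C_q(X)$ with $\sigma_k^*(\sigma_j)=\delta_{kj}$ for all $q$-simplices $\sigma_j$. For $(b_i,d_i)\in D_q(\mathbb{X})$ with $d_i<\infty$ and each $m$, put $\mathcal{F}_m=\{\sigma_k \ m\text{-simplex}\mid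 b_i<k<d_i\}$. A chain $z\in C_{q+1}(X)$ is a persistent volume for $(b_i,d_i)$ if: (1) $z=\sigma_{d_i}+\sum_{\sigma_k\in\mathcal{F}_{q+1}}\alpha_k\sigma_k$ for some $\alpha_k\in\Bbbk$; (2) $\tau^*(\partial z)=0$ for all $\tau\in\mathcal{F}_q$; (3) $\sigma_{b_i}^*(\partial z)\ne 0$. *)

(* Defs.v *)
From HB Require Import structures.
From mathcomp Require Import all_boot all_order all_algebra.

Set Implicit Arguments.
Unset Strict Implicit.
Unset Printing Implicit Defensive.

Import Order.TTheory GRing.Theory.
Local Open Scope ring_scope.
Local Open Scope quotient_scope.

Section QuotientSpace.
Variables (F : fieldType) (E : vectType F) (W : {vspace E}).

Definition quot_space : Type := Quotient.quot (pred_of_vspace W).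

HB.instance Definition _ := GRing.Zmodule.on quot_space.

Definition quot_proj (u : E) : quot_space := \pi u.

Definition quot_scale (a : F) (x : quot_space) : quot_space :=
  quot_proj (a *: repr x).

Lemma quot_projK (x : quot_space) : quot_proj (repr x) = x.
Proof. exact: reprK. Qed.

Lemma eq_quot_proj (u v : E) : quot_proj u = quot_proj v <-> u - v \in W.
Proof. by rewrite Quotient.idealrBE; split=> /eqP. Qed.

Lemma quot_projD (u v : E) : quot_proj (u + v) = quot_proj u + quot_proj v.
Proof. by rewrite /quot_proj [RHS]piE. Qed.

Lemma repr_quot_proj (u : E) : repr (quot_proj u) - u \in W.
Proof. by apply/eq_quot_proj; rewrite quot_projK. Qed.

Lemma quot_proj_scale a (u : E) :
  quot_proj (a *: u) = quot_scale a (quot_proj u).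
Proof.
apply/eq_quot_proj.
by rewrite -scalerBr -opprB scalerN rpredN rpredZ// repr_quot_proj.
Qed.

Fact quot_scaleA a b x : quot_scale a (quot_scale b x) = quot_scale (a * b) x.
Proof.
by rewrite -[x]quot_projK -!quot_proj_scale scalerA.
Qed.

Fact quot_scale1 : left_id 1 quot_scale.
Proof. by move=> x; rewrite /quot_scale scale1r quot_projK. Qed.

Fact quot_scaleDr : right_distributive quot_scale +%R.
Proof.
move=> a x y; rewrite -[x]quot_projK -[y]quot_projK -quot_projD.
by rewrite -!quot_proj_scale scalerDr quot_projD.
Qed.

Fact quot_scaleDl x : {morph quot_scale^~ x : a b / a + b}.
Proof. by move=> a b; rewrite /quot_scale scalerDl quot_projD. Qed.

HB.instance Definition _ := GRing.Zmodule_isLmodule.Build F quot_space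
  quot_scaleA quot_scale1 quot_scaleDr quot_scaleDl.

Fact quot_proj_linear : linear quot_proj.
Proof. by move=> a u v; rewrite quot_projD quot_proj_scale. Qed.

HB.instance Definition _ := GRing.isLinear.Build F E quot_space _ quot_proj
  quot_proj_linear.

End QuotientSpace.

Record persistence_module (F : fieldType) (K : nat) := PersistenceModule {
  pm_space : 'I_K.+1 -> lmodType F;
  pm_map : forall s t : 'I_K.+1, (s <= t)%N -> pm_space s -> pm_space t;
  pm_map_linear : forall (s t : 'I_K.+1) (st : (s <= t)%N), linear (pm_map st);
  pm_map_id : forall (s : 'I_K.+1) (ss : (s <= s)%N) x, pm_map ss x = x;
  pm_map_comp : forall (s t u : 'I_K.+1) (st : (s <= t)%N) (tu : (t <= u)%N)
    (su : (s <= u)%N) x, pm_map tu (pm_map st x) = pm_map su x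
}.

Definition pm_isomorphic (F : fieldType) (K : nat)
    (U W : persistence_module F K) : Prop :=
  exists phi : forall k, {linear pm_space U k -> pm_space W k},
    (forall k, bijective (phi k)) /\
    (forall (s t : 'I_K.+1) (st : (s <= t)%N) x,
       phi t (pm_map st x) = pm_map st (phi s x)).

Section DirectSum.
Variables (F : fieldType) (K : nat).
Implicit Types U W : persistence_module F K.

Definition pm_zero : persistence_module F K.
Proof.
by exists (fun=> 'rV[F]_0 : lmodType F) (fun _ _ _ => id).
Defined.

Definition pm_sum U W : persistence_module F K.
Proof.
exists (fun k => (pm_space U k * pm_space W k)%type : lmodType F)
  (fun _ _ st x => (pm_map st x.1, pm_map st x.2)).
- by move=> s t st a x y /=; rewrite !pm_map_linear.
- by move=> s ss [x y] /=; rewrite !pm_map_id.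
- by move=> s t u st tu su x /=; rewrite !(pm_map_comp _ _ su).
Defined.

End DirectSum.

(* A pair (b, d) with d = None standing for an infinite death index.          *)
Definition birth_death (K : nat) : Type := ('I_K.+1 * option 'I_K.+1)%type.

HB.instance Definition _ K := Equality.on (birth_death K).

Section Intervals.
Variables (F : fieldType) (K : nat).
Implicit Type bd : birth_death K.

Definition born_before_death bd : bool :=
  if bd.2 is Some d then (bd.1 < d)%N else true.

Definition alive bd (k : 'I_K.+1) : bool :=
  (bd.1 <= k)%N && (if bd.2 is Some d then (k < d)%N else true).

(* The space at k is 'rV_1 or 'rV_0 according to the truth value of alive bd k,
   and pid_mx 1 is the identity matrix when both sizes are 1 (and the empty
   matrix otherwise).                                                         *)
Definition interval_module bd : persistence_module F K.
Proof.
exists (fun k => 'rV[F]_(alive bd k) : lmodType F)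
  (fun _ _ _ x => x *m pid_mx 1).
- by move=> s t _ a x y /=; rewrite mulmxDl scalemxAl.
- move=> s _ /=; case: (alive bd s) => x; last by rewrite [x]thinmx0 mul0mx.
  by rewrite pid_mx_1 mulmx1.
- move=> s t u st tu _ x /=; rewrite -mulmxA mul_pid_mx; congr (x *m _).
  have : alive bd s -> alive bd u -> alive bd t.
    rewrite /alive; case: bd x => b [d|] x /=; last first.
      by rewrite !andbT => bs _; exact: leq_trans bs st.
    move=> /andP[bs _] /andP[_ ud].
    by rewrite (leq_trans bs st) (leq_ltn_trans tu ud).
  case: (alive bd s) x => x; last by rewrite [LHS]flatmx0 [RHS]flatmx0.
  case: (alive bd u); last by rewrite [LHS]thinmx0 [RHS]thinmx0.
  by move=> /(_ isT isT) ->.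
Defined.

Definition interval_sum (D : seq (birth_death K)) : persistence_module F K :=
  foldr (fun bd => pm_sum (interval_module bd)) (pm_zero F K) D.

End Intervals.

Section SimplicialHomology.
Variables (F : fieldType) (disp : Order.disp_t) (V : finOrderType disp).
Implicit Types (A B X : {set {set V}}) (s t : {set V}) (m q : nat).

Definition simplicial_complex A : Prop :=
  set0 \notin A /\
  forall s t, s \in A -> t \subset s -> t != set0 -> t \in A.

Definition subcomplex A X : Prop := A \subset X /\ simplicial_complex A.

Definition is_simplex m s : bool := #|s| == m.+1.

(* Chains of every dimension and of every complex on V live in one ambient
   space; C_q(A) is the subspace chains q A below, so that the chain maps
   induced by inclusions of complexes are inclusions of subspaces.            *)
Definition chain : Type := {ffun {set V} -> F^o}.

HB.instance Definition _ := Vector.on chain.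

(* The coefficient of s in c. On chains q A, it is the linear functional dual
   to the q-simplex s; it vanishes there if s is not a q-simplex.             *)
Definition dual s (c : chain) : F := c s.

Definition simplex_chain s : chain := [ffun t => (t == s)%:R].

Definition chains q A : {vspace chain} :=
  (\sum_(s in A | is_simplex q s) <[simplex_chain s]>)%VS.

(* Simplices are oriented by the order of V: for s = {v_0 < ... < v_q}, this is
   \sum_i (-1)^i [v_0, ..., v_(i-1), v_(i+1), ..., v_q], the exponent being the
   number of vertices before v_i. The empty face of a vertex is discarded.    *)
Definition simplex_boundary s : chain :=
  \sum_(v in s | s :\ v != set0)
    (-1) ^+ #|[set w in s | (w < v)%O]| *: simplex_chain (s :\ v).

Definition boundary_fun (c : chain) : chain :=
  \sum_s dual s c *: simplex_boundary s.

Fact boundary_fun_linear : linear boundary_fun.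
Proof.
move=> a c c'; rewrite /boundary_fun scaler_sumr -big_split /=.
by apply: eq_bigr => s _; rewrite /dual !ffunE scalerDl scalerA.
Qed.

HB.instance Definition _ := GRing.isLinear.Build F chain chain _ boundary_fun
  boundary_fun_linear.

Definition boundary : 'End(chain) := linfun boundary_fun.

Definition cycles q A : {vspace chain} := (chains q A :&: lker boundary)%VS.

Definition boundaries q A : {vspace chain} := (boundary @: chains q.+1 A)%VS.

Lemma boundary_simplex s : boundary (simplex_chain s) = simplex_boundary s.
Proof.
rewrite lfunE /= /boundary_fun (bigD1 s)//= big1 ?addr0 /dual.
  by rewrite ffunE eqxx scale1r.
by move=> t /negPf ts; rewrite ffunE ts scale0r.
Qed.

Lemma boundary_boundary (c : chain) : boundary (boundary c) = 0.
Proof.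
rewrite [boundary c]lfunE /= /boundary_fun linear_sum big1// => s _.
rewrite linearZ /=.
suff -> : boundary (simplex_boundary s) = 0 by rewrite scaler0.
pose n s v := #|[set w in s | (w < v)%O]|.
pose ok v w := [&& v \in s, w \in s & s :\ v :\ w != set0].
pose G v w : chain :=
  ((-1) ^+ n s v * (-1) ^+ n (s :\ v) w) *: simplex_chain (s :\ v :\ w).
have GN v w : v \in s -> (v < w)%O -> G w v = - G v w.
  move=> vs vw; rewrite /G.
  have -> : s :\ w :\ v = s :\ v :\ w.
    by apply/setP => x; rewrite !inE; do !case: (_ == _).
  have -> : n (s :\ w) v = n s v.
    apply: eq_card => x; rewrite !inE; case: eqP => //= ->.
    by rewrite ltNge (ltW vw) andbF.
  have -> : n s w = (n (s :\ v) w).+1.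
    rewrite /n (cardsD1 v) !inE vs vw add1n; congr _.+1.
    by apply: eq_card => x; rewrite !inE andbA.
  by rewrite exprS mulN1r mulNr scaleNr mulrC.
transitivity (\sum_v \sum_(w | (w != v) && ok v w) G v w).
  rewrite /simplex_boundary linear_sum big_mkcond; apply: eq_bigr => v _ /=.
  case: ifP => [/andP[vs s0]|/negbT vs].
    rewrite linearZ /= boundary_simplex /simplex_boundary scaler_sumr.
    apply: eq_big => [w|w _]; last by rewrite scalerA.
    by rewrite /ok !inE vs /= andbA.
  rewrite big1// => w /andP[wv /and3P[vs' ws sn]].
  case/negP: vs; rewrite vs' /=.
  by apply/set0Pn; exists w; rewrite !inE wv.
rewrite (eq_bigr (fun v => \sum_(w | (w < v)%O && ok v w) G v w
   + \sum_(w | (v < w)%O && ok v w) G v w)); last first.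
  move=> v _; rewrite (bigID (fun w => (w < v)%O)) /=; congr (_ + _).
    by apply: eq_bigl => w; case: ltgtP; rewrite ?andbF ?andbT.
  by apply: eq_bigl => w; case: ltgtP; rewrite ?andbF ?andbT.
rewrite big_split /= (exchange_big_dep xpredT) //= -big_split big1//= => v _.
apply/eqP; rewrite addr_eq0 -sumrN; apply/eqP.
have E w : ok w v = ok v w.
  rewrite /ok !andbA [(w \in s) && _]andbC; congr (_ && (_ != _)).
  by apply/setP => x; rewrite !inE; do !case: (_ == _).
apply: eq_big => [w|w /andP[vw /and3P[_ vs _]]]; first by rewrite E.
exact: GN.
Qed.

Lemma boundaries_cycles q A : simplicial_complex A ->
  (boundaries q A <= cycles q A)%VS.
Proof.
case=> _ Aface; apply/subvP => _ /memv_imgP[c cA ->].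
rewrite memv_cap memv_ker boundary_boundary eqxx andbT.
suff /subvP : (chains q.+1 A <= boundary @^-1: chains q A)%VS.
  by move=> /(_ _ cA); rewrite -memv_preim.
apply/subv_sumP => s /andP[sA /eqP sq].
rewrite -memvE -memv_preim boundary_simplex.
apply: memv_suml => v /andP[vs s0]; apply: memvZ.
suff P : (s :\ v \in A) && is_simplex q (s :\ v).
  by rewrite memvE (sumv_sup (s :\ v)).
rewrite (Aface _ _ sA (subD1set s v) s0) /is_simplex /=.
by move: sq; rewrite (cardsD1 v) vs add1n => -[->].
Qed.

Definition homology q A : Type :=
  quot_space (linfun (vsval : subvs_of (cycles q A) -> chain)
              @^-1: boundaries q A)%VS.

HB.instance Definition _ q A := GRing.Lmodule.on (homology q A).

Definition homology_map q A B (x : homology q A) : homology q B :=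
  quot_proj _ (vsproj (cycles q B) (vsval (repr x))).

Lemma chainsS q A B : A \subset B -> (chains q A <= chains q B)%VS.
Proof.
move=> /subsetP AB; apply/subv_sumP => s /andP[sA sq].
by apply: (sumv_sup s); rewrite ?AB.
Qed.

Lemma cyclesS q A B : A \subset B -> (cycles q A <= cycles q B)%VS.
Proof. by move=> AB; apply: capvS (chainsS q AB) _. Qed.

Lemma boundariesS q A B : A \subset B -> (boundaries q A <= boundaries q B)%VS.
Proof. by move=> AB; apply/limgS/chainsS. Qed.

Lemma homology_eq q A (x y : subvs_of (cycles q A)) :
  quot_proj _ x = quot_proj _ y :> homology q A
  <-> vsval x - vsval y \in boundaries q A.
Proof.
split=> [/eq_quot_proj|xy]; last apply/eq_quot_proj.
  by rewrite -memv_preim lfunE linearB.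
by rewrite -memv_preim lfunE linearB.
Qed.

Lemma homology_map_proj q A B (x : subvs_of (cycles q A)) : A \subset B ->
  homology_map B (quot_proj _ x : homology q A)
  = quot_proj _ (vsproj (cycles q B) (vsval x)).
Proof.
move=> AB; apply/homology_eq.
rewrite !vsprojK ?(subvP (cyclesS q AB)) ?subvsP//.
apply: (subvP (boundariesS q AB)); apply/homology_eq.
by rewrite quot_projK.
Qed.

Lemma homology_map_linear q A B : A \subset B -> linear (@homology_map q A B).
Proof.
move=> AB a x y; rewrite -[x]quot_projK -[y]quot_projK.
have projZ C u v : a *: (quot_proj _ u : homology q C) + quot_proj _ v
    = quot_proj _ (a *: u + v).
  by rewrite [RHS]quot_projD quot_proj_scale.
by rewrite projZ !homology_map_proj// projZ !linearP.
Qed.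

Lemma homology_map_id q A x : @homology_map q A A x = x.
Proof.
by rewrite -[x]quot_projK homology_map_proj// vsvalK.
Qed.

Lemma homology_map_comp q A B (C : {set {set V}}) x :
  A \subset B -> B \subset C ->
  @homology_map q B C (@homology_map q A B x) = @homology_map q A C x.
Proof.
move=> AB BC; rewrite -[x]quot_projK !homology_map_proj//.
  by rewrite vsprojK// (subvP (cyclesS q AB)) ?subvsP.
exact: subset_trans BC.
Qed.

End SimplicialHomology.

Section Filtration.
Variables (F : fieldType) (disp : Order.disp_t) (V : finOrderType disp).
Variables (K : nat) (X : K.-tuple {set V}) (q : nat).

(* Simplices are numbered from 1 to K; the index 0 gives set0, which is not a
   simplex.                                                                   *)
Definition sigma (k : nat) : {set V} := nth set0 (set0 :: X) k.

Definition sublevel (k : nat) : {set {set V}} := [set s in take k X].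

Lemma sublevelS s t : (s <= t)%N -> sublevel s \subset sublevel t.
Proof.
move=> st; apply/subsetP => x; rewrite !inE.
by rewrite -(subnKC st) takeD mem_cat => ->.
Qed.

Definition persistent_homology : persistence_module F K :=
  {| pm_space := fun k : 'I_K.+1 => homology F q (sublevel k);
     pm_map := fun s t _ => @homology_map F _ _ q (sublevel s) (sublevel t);
     pm_map_linear := fun _ _ st => homology_map_linear (sublevelS st);
     pm_map_id := fun _ _ => @homology_map_id _ _ _ _ _;
     pm_map_comp := fun _ _ _ st tu _ x =>
       homology_map_comp x (sublevelS st) (sublevelS tu) |}.

(* The multiset D is given as a list, in any order.                           *)
Definition persistence_diagram (D : seq (birth_death K)) : Prop :=
  all (@born_before_death K) D /\
  pm_isomorphic persistent_homology (interval_sum F D).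

Definition between (m : nat) (b d : 'I_K.+1) : {set 'I_K.+1} :=
  [set k : 'I_K.+1 | (b < k < d)%N && is_simplex m (sigma k)].

Definition persistent_volume (b d : 'I_K.+1) (z : chain F V) : Prop :=
  [/\ z \in chains F q.+1 [set s in X],
      exists alpha : 'I_K.+1 -> F,
        z = simplex_chain F (sigma d) +
            \sum_(k in between q.+1 b d) alpha k *: simplex_chain F (sigma k),
      forall k, k \in between q b d -> dual (sigma k) (boundary F V z) = 0
    & dual (sigma b) (boundary F V z) != 0].

End Filtration.

(* Main.v *)
Require Import Defs.
From mathcomp Require Import all_boot all_order all_algebra.

Set Implicit Arguments.
Unset Strict Implicit.
Unset Printing Implicit Defensive.

Import GRing.Theory.
Local Open Scope ring_scope.

(** A bar (b, d) of the barcode carries a class that is born exactly at b and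
    dies exactly at d: its generator at index b vanishes at d, and at any
    earlier t it is nonzero and differs from everything coming from an index
    below b ([interval_class]). This property passes from an interval module to
    any direct sum containing it, and across isomorphisms of persistence
    modules, so the homology of X_b contains such a class.

    Let the cycle c of X_b represent it ([interval_class_cycle]). Since the
    class dies at d, c is the boundary of some w in C_(q+1)(X_d), while c is not
    homologous in X_(d-1) to any cycle of X_(b-1). In particular c is not a
    boundary in X_(d-1), so the coefficient a of sigma_d in w is nonzero. Let u
    be the part of w carried by X_b and put z := a^-1 (w - u)
    ([persistent_volume_cycle]). By construction z is sigma_d plus a combination
    of (q+1)-simplices with indices strictly between b and d. Its boundary
    a^-1 (c - boundary u) is a cycle of X_b, hence vanishes on the q-simplices
    of index above b. If it vanished on sigma_b as well, then a times it would
    be a cycle of X_(b-1) differing from c by the boundary of u, which lies in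
    X_b and so in X_(d-1); this contradicts the choice of c. *)

(** * Classes born at b and dying at d *)

(** Nonvanishing has to be required in addition to differing from the classes
    of smaller index: the latter is vacuous when b = 0, where nonvanishing rules
    out such a class in the homology of the empty complex. *)
Definition interval_class (F : fieldType) (K : nat)
    (U : persistence_module F K) (b d : 'I_K.+1) (x : pm_space U b) : Prop :=
  (forall bd : (b <= d)%N, pm_map bd x = 0) /\
  forall (t : 'I_K.+1) (bt : (b <= t)%N), (t < d)%N ->
    pm_map bt x <> 0 /\
    forall (s : 'I_K.+1) (st : (s <= t)%N) (y : pm_space U s),
      (s < b)%N -> pm_map bt x <> pm_map st y.

Section IntervalClasses.
Variables (F : fieldType) (K : nat).
Implicit Types (U W : persistence_module F K) (b d : 'I_K.+1).

Lemma pm_map0 U (s t : 'I_K.+1) (st : (s <= t)%N) :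
  pm_map st (0 : pm_space U s) = 0.
Proof.
have := pm_map_linear st (-1) (0 : pm_space U s) 0.
by rewrite scaler0 addr0 scaleN1r addNr.
Qed.

Lemma interval_class_sumr U W b d (x : pm_space W b) :
  interval_class d x ->
  interval_class (U := pm_sum U W) d ((0, x) : pm_space (pm_sum U W) b).
Proof.
case=> xd xt; split=> [bd|t bt td] /=; first by rewrite pm_map0 xd.
have [x0 xs] := xt t bt td.
by split=> [[_ /x0]|s st y sb [_ /xs]] //; apply.
Qed.

Lemma interval_class_suml U W b d (x : pm_space U b) :
  interval_class d x ->
  interval_class (U := pm_sum U W) d ((x, 0) : pm_space (pm_sum U W) b).
Proof.
case=> xd xt; split=> [bd|t bt td] /=; first by rewrite pm_map0 xd.
have [x0 xs] := xt t bt td.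
by split=> [[/x0]|s st y sb [/xs]] //; apply.
Qed.

Lemma interval_class_module b d : (b < d)%N ->
  interval_class (U := interval_module F (b, Some d)) (b := b) d (const_mx 1).
Proof.
move=> lt_bd; split=> [bd|t bt td] /=.
  by apply/rowP=> -[j lt_j]; exfalso; move: lt_j; rewrite /alive /= ltnn andbF.
have bb : alive (b, Some d) b by rewrite /alive /= leqnn lt_bd.
have ta : alive (b, Some d) t by rewrite /alive /= bt td.
have nz : (const_mx 1 : 'rV[F]_(alive (b, Some d) b)) *m pid_mx 1 <>
    0 :> 'rV[F]_(alive (b, Some d) t).
  rewrite bb ta pid_mx_1 mulmx1 => /rowP/(_ ord0)/eqP.
  by rewrite !mxE oner_eq0.
split=> // s st y sb eq_y; apply: nz; rewrite eq_y.
suff -> : y = 0 by rewrite mul0mx.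
apply/rowP=> -[j lt_j]; exfalso.
by move: lt_j; rewrite /alive /= [(b <= s)%N]leqNgt sb.
Qed.

(** Projecting the sum onto the chosen interval summand detects both
    nonvanishing and not coming from an earlier index, so padding the generator
    with zeros in the other summands keeps it an interval class. *)
Lemma interval_class_interval_sum (D : seq (birth_death K)) b d :
  all (@born_before_death K) D -> (b, Some d) \in D ->
  exists x : pm_space (interval_sum F D) b, interval_class d x.
Proof.
elim: D => //= bd D IH /andP[bdP DP]; rewrite inE => /orP[/eqP bd_eq|/(IH DP)].
  subst bd; exists (const_mx 1, 0); apply: interval_class_suml.
  exact: interval_class_module.
by case=> x xP; exists (0, x); apply: interval_class_sumr.
Qed.

Lemma interval_class_iso U W b d (x : pm_space W b) :
  pm_isomorphic U W -> interval_class d x ->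
  exists x' : pm_space U b, interval_class d x'.
Proof.
case=> phi [phi_bij phi_map] [xd xt].
have [psi phiK psiK] := phi_bij b.
exists (psi x); split=> [bd|t bt td].
  by apply: (bij_inj (phi_bij d)); rewrite phi_map psiK xd linear0.
have [x0 xs] := xt t bt td; split=> [|s st y sb] /(congr1 (phi t)).
  by rewrite phi_map psiK linear0.
by rewrite !phi_map psiK; apply: xs.
Qed.

End IntervalClasses.

(** * Coordinates of chains *)

Section Chains.
Variables (F : fieldType) (disp : Order.disp_t) (V : finOrderType disp).
Implicit Types (A B : {set {set V}}) (s : {set V}) (c : chain F V) (q : nat).

Lemma chainE c : c = \sum_s c s *: simplex_chain F s.
Proof.
apply/ffunP=> t; rewrite sum_ffunE (bigD1 t) //= big1 ?addr0 => [|s st].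
  by rewrite !ffunE eqxx /GRing.scale /= mulr1.
by rewrite !ffunE eq_sym (negPf st) scaler0.
Qed.

Lemma chainsP q A c :
  reflect (forall s, c s != 0 -> (s \in A) && is_simplex q s)
          (c \in chains F q A).
Proof.
apply: (iffP idP) => [/memv_sumP[v v_in ->] s|cA]; last first.
  rewrite [c]chainE; apply: memv_suml => s _.
  have [->|/cA sA] := eqVneq (c s) 0; first by rewrite scale0r mem0v.
  by apply: memvZ; rewrite memvE (sumv_sup s).
apply: contraR => sA; rewrite sum_ffunE big1 // => t tA.
have /vlineP[a ->] := v_in t tA; rewrite !ffunE.
by case: eqP => [ts|_]; [rewrite ts tA in sA | rewrite scaler0].
Qed.

Definition restrict A c : chain F V := [ffun s => if s \in A then c s else 0].

Lemma restrict_chains q A B c :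
  c \in chains F q B -> restrict A c \in chains F q A.
Proof.
move/chainsP=> cB; apply/chainsP=> s; rewrite ffunE.
by case: ifP => [_ /cB/andP[]|]; rewrite ?eqxx.
Qed.

End Chains.

(** * Simplexwise filtrations *)

Section Filtrations.
Variables (F : fieldType) (disp : Order.disp_t) (V : finOrderType disp).
Variables (K : nat) (X : K.-tuple {set V}).

Lemma mem_sublevel0 s : s \in sublevel X 0 = false.
Proof. by rewrite inE take0. Qed.

Lemma sublevel_sigma n s : s \in sublevel X n ->
  exists k : 'I_K.+1, (0 < k <= n)%N /\ s = sigma X k.
Proof.
rewrite inE => sn; have sX := mem_take sn.
have := sn; rewrite in_take // => lt_n.
have lt_K : (index s X < K)%N.
  by rewrite -[K in (_ < K)%N](size_tuple X) index_mem.
exists (Ordinal (lt_K : (index s X).+1 < K.+1)%N).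
by rewrite /sigma /= nth_index.
Qed.

Hypothesis X_uniq : uniq X.

Lemma sigma_sublevel (k : 'I_K.+1) n : (0 < k)%N ->
  (sigma X k \in sublevel X n) = (k <= n)%N.
Proof.
case: k => -[|k] lt_k //= _; rewrite inE /sigma /=.
have lt_kX : (k < size X)%N by rewrite size_tuple.
by rewrite in_take ?mem_nth // index_uniq.
Qed.

Lemma sigma_inj (j k : 'I_K.+1) : (0 < j)%N -> (0 < k)%N ->
  sigma X j = sigma X k -> j = k.
Proof.
move=> j0 k0 jk; apply/val_inj/anti_leq.
have jk_le : (j <= k)%N by rewrite -sigma_sublevel // jk sigma_sublevel.
by rewrite jk_le /= -sigma_sublevel // -jk sigma_sublevel.
Qed.

(** Since X_k and X_(k-1) differ by the single simplex sigma_k, the filtration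
    level of a chain drops as soon as its coefficient on sigma_k vanishes. *)
Lemma chains_sublevel_pred q (k : 'I_K.+1) (c : chain F V) :
  c \in chains F q (sublevel X k) -> c (sigma X k) = 0 ->
  c \in chains F q (sublevel X k.-1).
Proof.
move=> /chainsP cX ck; apply/chainsP=> s cs; have /andP[sX ->] := cX s cs.
have [j [/andP[j0 jk] sj]] := sublevel_sigma sX.
rewrite andbT sj sigma_sublevel //.
rewrite -ltnS (ltn_predK (leq_trans j0 jk)) ltn_neqAle jk andbT.
by apply: contraNneq cs => /val_inj j_k; rewrite sj j_k ck.
Qed.

(** The chain-level form of an interval class of persistent homology. The
    position b = 0 is excluded because the homology of the empty complex is 0;
    for b > 0, the case e = 0 of the last clause says that c is not yet a
    boundary in X_(d-1). *)
Lemma interval_class_cycle q (b d : 'I_K.+1)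
    (x : pm_space (persistent_homology F X q) b) :
  (b < d)%N -> interval_class d x ->
  (0 < b)%N /\
  exists c, [/\ c \in cycles F q (sublevel X b),
    c \in boundaries F q (sublevel X d) &
    forall e, e \in cycles F q (sublevel X b.-1) ->
      c - e \notin boundaries F q (sublevel X d.-1)].
Proof.
move=> lt_bd [xd xt].
have lt_dK : (d.-1 < K.+1)%N by apply: leq_ltn_trans (leq_pred _) (ltn_ord d).
have lt_bK : (b.-1 < K.+1)%N by apply: leq_ltn_trans (leq_pred _) (ltn_ord b).
have d_gt0 : (0 < d)%N by apply: leq_ltn_trans lt_bd.
pose t := Ordinal lt_dK; pose s := Ordinal lt_bK.
have bt : (b <= t)%N by rewrite -ltnS /= prednK.
have td : (t < d)%N by rewrite /= prednK.
have st : (s <= t)%N by apply: leq_trans (leq_pred _) bt.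
have [x0 xs] := xt t bt td.
pose r : subvs_of (cycles F q (sublevel X b)) := repr x.
have xE : x = quot_proj _ r by rewrite quot_projK.
have rX n : (b <= n)%N -> vsval r \in cycles F q (sublevel X n).
  by move=> bn; apply: (subvP (cyclesS F q (sublevelS X bn))); apply: subvsP.
have b_gt0 : (0 < b)%N.
  rewrite lt0n; apply/eqP=> b0; apply: x0.
  suff -> : x = 0 by apply: pm_map0.
  rewrite xE; suff -> : r = 0 by apply: linear0.
  apply/val_inj/ffunP=> u /=; rewrite ffunE; apply/eqP.
  have /memv_capP[/chainsP rC _] := subvsP r.
  by apply: contraT => /rC; rewrite b0 mem_sublevel0.
split=> //; exists (vsval r); split; first exact: subvsP.
  have := xd (ltnW lt_bd); rewrite /= xE homology_map_proj ?sublevelS 1?ltnW //.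
  rewrite -(linear0 (quot_proj _)) => /homology_eq.
  by rewrite linear0 addr0 vsprojK ?rX // ltnW.
move=> e eX; apply/negP=> re.
have sb : (s < b)%N by rewrite /= prednK.
have := xs s st (quot_proj _ (vsproj (cycles F q (sublevel X s)) e)) sb.
apply; rewrite /= xE !homology_map_proj ?(sublevelS X bt) ?(sublevelS X st) //.
apply/homology_eq; rewrite (vsprojK eX).
have eX' := subvP (cyclesS F q (sublevelS X st)) _ eX.
by rewrite (vsprojK eX') (vsprojK (rX t bt)).
Qed.

(** A chain w of X_d with boundary c becomes a persistent volume once its part
    in X_b is removed and its coefficient on sigma_d is normalized: the removed
    part changes the boundary only by a boundary of X_b, which affects neither
    the vanishing above b nor the homology class of c at d-1. *)
Lemma persistent_volume_cycle q (b d : 'I_K.+1) (c : chain F V) :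
  simplicial_complex (sublevel X b) -> (0 < b)%N -> (b < d)%N ->
  c \in cycles F q (sublevel X b) -> c \in boundaries F q (sublevel X d) ->
  (forall e, e \in cycles F q (sublevel X b.-1) ->
    c - e \notin boundaries F q (sublevel X d.-1)) ->
  exists z : chain F V, persistent_volume X q b d z.
Proof.
move=> X_b b_gt0 lt_bd cX /memv_imgP[w wX cE] c_new.
have d_gt0 : (0 < d)%N by apply: leq_ltn_trans lt_bd.
have le_bd' : (b <= d.-1)%N by rewrite -ltnS prednK.
pose a := w (sigma X d).
have a_neq0 : a != 0.
  apply: contraNneq (c_new 0 (mem0v _)) => a0.
  by rewrite subr0 cE; apply/memv_img/chains_sublevel_pred.
pose u := restrict (sublevel X b) w.
have uX : u \in chains F q.+1 (sublevel X b) := restrict_chains _ wX.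
pose z := a^-1 *: (w - u).
have zX : z \in chains F q.+1 (sublevel X d).
  apply/memvZ/rpredB => //.
  by apply: (subvP (chainsS F _ (sublevelS X (ltnW lt_bd)))).
have z_old s : s \in sublevel X b -> z s = 0.
  by move=> sb; rewrite !ffunE sb subrr scaler0.
have zd : z (sigma X d) = 1.
  rewrite !ffunE sigma_sublevel // leqNgt lt_bd /= subr0.
  exact: mulVf.
have bzE : boundary F V z = a^-1 *: (c - boundary F V u).
  by rewrite /z linearZ linearB /= -cE.
have buX : boundary F V u \in boundaries F q (sublevel X b) by apply: memv_img.
have bzX : boundary F V z \in cycles F q (sublevel X b).
  by rewrite bzE; apply/memvZ/rpredB/(subvP (boundaries_cycles F q X_b)).
(* From here on z is known only by its values on X_b and sigma_d and by its
   boundary; keeping it opaque stops ffunE from unfolding its coefficients. *)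
clearbody z; exists z; split.
- apply: (subvP (chainsS F _ _)) zX.
  by apply/subsetP=> s; rewrite !inE; apply: mem_take.
- exists (fun k => z (sigma X k)); apply/ffunP=> s.
  rewrite [RHS]ffunE sum_ffunE.
  have [->|s_d] := eqVneq s (sigma X d).
    rewrite zd ffunE eqxx big1 ?addr0 // => k.
    rewrite inE => /andP[/andP[bk kd] _].
    rewrite !ffunE; case: eqP => [dk|_]; last by rewrite scaler0.
    have k_gt0 : (0 < k)%N by apply: leq_ltn_trans bk.
    by rewrite (sigma_inj d_gt0 k_gt0 dk) ltnn in kd.
  rewrite ffunE (negPf s_d) add0r.
  have [zs0|zs] := eqVneq (z s) 0.
    rewrite zs0 big1 // => k _; rewrite !ffunE.
    by case: eqP => [<-|_]; rewrite ?zs0 ?scale0r ?scaler0.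
  have /andP[sX sq] := chainsP _ _ _ zX s zs.
  have [j [/andP[j_gt0 jd] sj]] := sublevel_sigma sX.
  have bj : (b < j)%N.
    rewrite ltnNge -sigma_sublevel // -sj.
    by apply: contra zs => /z_old->.
  have j_in : j \in between X q.+1 b d.
    rewrite inE bj -sj sq andbT ltn_neqAle jd andbT.
    by apply: contraNneq s_d => /val_inj <-; rewrite sj.
  rewrite (bigD1 j) //= big1 ?addr0 => [|k /andP[]].
    by rewrite !ffunE -sj eqxx /GRing.scale /= mulr1.
  rewrite inE => /andP[/andP[bk _] _] k_j; rewrite !ffunE sj.
  case: eqP => [jk|_]; last by rewrite scaler0.
  have k_gt0 : (0 < k)%N by apply: leq_ltn_trans bk.
  by rewrite (sigma_inj j_gt0 k_gt0 jk) eqxx in k_j.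
- move=> k; rewrite inE => /andP[/andP[bk _] _]; apply/eqP.
  have k_gt0 : (0 < k)%N by apply: leq_ltn_trans bk.
  have /memv_capP[/chainsP bzC _] := bzX.
  by apply: contraT => /bzC; rewrite sigma_sublevel // leqNgt bk.
apply/negP=> /eqP bz0; have /memv_capP[bzC bzK] := bzX.
have bzX' : a *: boundary F V z \in cycles F q (sublevel X b.-1).
  by apply/memvZ; rewrite memv_cap bzK chains_sublevel_pred.
(* What separates c from a *: boundary z is the boundary of u. *)
have /negP := c_new _ bzX'; apply.
rewrite bzE scalerA mulfV // scale1r opprB addrC subrK.
exact: subvP (boundariesS F q (sublevelS X le_bd')) _ buX.
Qed.

End Filtrations.

Theorem theorem4 (F : fieldType) (disp : Order.disp_t) (V : finOrderType disp)
    (K : nat) (X : K.-tuple {set V})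
    (X_uniq : uniq X)
    (X_complex : simplicial_complex [set s in X])
    (X_filtration : forall k : nat, (1 <= k <= K)%N ->
       subcomplex (sublevel X k) [set s in X])
    (q : nat) (D : seq (birth_death K))
    (D_diagram : persistence_diagram F X q D) (b d : 'I_K.+1) :
  (b, Some d) \in D ->
  exists z : chain F V, persistent_volume X q b d z.
Proof.
move=> bdD; have [D_lt D_iso] := D_diagram.
have lt_bd : (b < d)%N := allP D_lt _ bdD.
have [x xP] := interval_class_interval_sum F D_lt bdD.
have [x' x'P] := interval_class_iso D_iso xP.
have [b_gt0 [c [cX c_bd c_new]]] := interval_class_cycle lt_bd x'P.
have X_b : simplicial_complex (sublevel X b).
  by case: (X_filtration b) => //; rewrite b_gt0 -ltnS ltn_ord.
exact: (persistent_volume_cycle X_uniq X_b b_gt0 lt_bd cX c_bd c_new).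
Qed.
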